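(* Let $E_{n,m}(k)$ denote the number of placements of $k$ indistinguishable rooks on an $n\times m$ chessboard such that each row and each column contains at least one rook. Then $$d_{R_{n,m}}(k) = \binom{nm}{k} - \sum_{r=1}^n \sum_{c=1}^m \binom{n}{r}\binom{m}{c} E_{n-r,m-c}(k).$$
   Context: The rook graph $R_{n,m}$ has as vertices the $nm$ squares of an $n\times m$ chessboard ($n$ rows, $m$ columns); two distinct squares are adjacent if and only if a rook can legally move from one to the other, i.e. they lie in the same row or in the same column (equivalently, $R_{n,m}$ is the cartesian product of the complete graphs $K_n$ and $K_m$). A subset $S$ of the vertices of a graph is a dominating set if every vertex is an element of $S$ or is adjacent to an element of $S$. $d_{R_{n,m}}(k)$ denotes the number of dominating sets of $R_{n,m}$ of cardinality $k$, i.e. the number of placements of $k$ rooks on the board such that every free square is attacked by at least one rook. A placement of $k$ rooks is a choice of $k$ distinct squares of the board (at most one rook per square). Binomial coefficients $\binom{N}{k}$ are zero when $k>N$. *)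

(* Defs.v *)
From mathcomp Require Import all_boot.
Set Implicit Arguments.
Unset Strict Implicit.
Unset Printing Implicit Defensive.

Definition dominating (T : finType) (e : rel T) (S : {set T}) : bool :=
  [forall v : T, (v \in S) || [exists u in S, e u v]].

Definition num_dominating (T : finType) (e : rel T) (k : nat) : nat :=
  #|[set S : {set T} | dominating e S & #|S| == k]|.

(* A square is a pair (row, column). *)
Definition square (n m : nat) : finType := ('I_n * 'I_m)%type.

Definition rook_adj (n m : nat) : rel (square n m) :=
  fun x y => (x != y) && ((x.1 == y.1) || (x.2 == y.2)).

(* Indistinguishable rooks, at most one per square: a placement is the set of
   occupied squares. The board may have no rows or no columns; in particular
   num_covering 0 0 0 = 1, counting the empty placement on the empty board. *)
Definition num_covering (n m k : nat) : nat :=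
  #|[set S : {set square n m} |
      [&& #|S| == k,
          [forall i : 'I_n, exists j : 'I_m, (i, j) \in S] &
          [forall j : 'I_m, exists i : 'I_n, (i, j) \in S]]]|.

(* Main.v *)
Require Import Defs.
From HB Require Import structures.
From mathcomp Require Import all_boot all_order all_algebra.
Set Implicit Arguments.
Unset Strict Implicit.
Unset Printing Implicit Defensive.
Import Order.TTheory GRing.Theory Num.Theory.
Local Open Scope ring_scope.

(** A square is neither occupied nor attacked exactly when its row and its
    column are both empty, so the placements that fail to dominate are those
    with at least one empty row and at least one empty column
    ([dominatingPn_rook]).  Sort them by their set [A] of empty rows and their
    set [B] of empty columns.  Deleting these rows and columns leaves a
    placement on a smaller board that meets every row and column, and the
    deletion is reversible, so each pair [(A, B)] accounts for
    [num_covering (n - #|A|) (m - #|B|) k] placements ([card_empty_lines]).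
    This depends only on the cardinals of [A] and [B]; grouping the pairs by
    cardinals [r, c >= 1] produces the binomial coefficients
    ([sum_nonempty_by_card]). *)

Definition empty_rows n m (S : {set square n m}) : {set 'I_n} :=
  [set i | [forall j, (i, j) \notin S]].

Definition empty_cols n m (S : {set square n m}) : {set 'I_m} :=
  [set j | [forall i, (i, j) \notin S]].

(** The row and the column of an unattacked free square are empty; conversely,
    an empty row and an empty column cross in such a square. *)
Lemma dominatingPn_rook n m (S : {set square n m}) :
  ~~ dominating (@rook_adj n m) S
    = (empty_rows S != set0) && (empty_cols S != set0).
Proof.
apply/idP/andP => [|[/set0Pn[i] + /set0Pn[j]]]; last first.
  rewrite !inE => /forallP Hi /forallP Hj.
  rewrite negb_forall; apply/existsP; exists (i, j).
  rewrite negb_or Hi /=; apply/existsPn => -[a b]; apply/negP => /andP[abS].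
  case/andP=> _ /= /orP[] /eqP e; move: abS.
    by rewrite e (negbTE (Hi _)).
  by rewrite e (negbTE (Hj _)).
rewrite negb_forall => /existsP[[i j]]; rewrite negb_or => /andP[ijS /existsPn H].
split; apply/set0Pn; [exists i | exists j]; rewrite inE; apply/forallP => a;
  apply/negP => aS.
- have := H (i, a); rewrite aS /rook_adj /= eqxx andbT negbK => /eqP[ea].
  by rewrite -ea aS in ijS.
- have := H (a, j); rewrite aS /rook_adj /= eqxx orbT andbT negbK => /eqP[ea].
  by rewrite -ea aS in ijS.
Qed.

Lemma setC_ord_embedding n (A : {set 'I_n}) :
  exists2 f : 'I_(n - #|A|) -> 'I_n,
    injective f & forall i, (i \in ~: A) = (i \in codom f).
Proof.
have eA : (n - #|A|)%N = #|~: A| by rewrite [RHS]cardsCs setCK card_ord.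
exists (fun x => enum_val (cast_ord eA x)).
  by move=> x y /enum_val_inj /cast_ord_inj.
move=> i; apply/idP/codomP => [iA | [x ->]]; last exact: enum_valP.
exists (cast_ord (esym eA) (enum_rank_in iA i)).
by rewrite cast_ordKV enum_rankK_in.
Qed.

(** Placements whose empty lines are exactly [A] and [B] are the images of the
    covering placements under the embedding of the smaller board onto
    [~: A] x [~: B]. *)
Lemma card_empty_lines n m k (A : {set 'I_n}) (B : {set 'I_m}) :
  #|[set S : {set square n m} |
      [&& #|S| == k, empty_rows S == A & empty_cols S == B]]|
    = num_covering (n - #|A|) (m - #|B|) k.
Proof.
(* The sizes of the smaller board mention [A] and [B]; abstracting them keeps
   later rewriting of [A] and [B] from being blocked by the type of [h]. *)
move: (n - #|A|)%N (m - #|B|)%N (setC_ord_embedding A) (setC_ord_embedding B).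
move=> n' m' [f fI fA] [g gI gB].
pose h (p : square n' m') : square n m := (f p.1, g p.2).
have hI : injective h by move=> [a b] [c d] [/fI -> /gI ->].
have hE x y (T : {set square _ _}) : ((f x, g y) \in h @: T) = ((x, y) \in T).
  exact: (mem_imset T (x, y) hI).
rewrite /num_covering -(card_imset _ (imset_inj hI)).
apply: eq_card => S; rewrite inE; apply/and3P/imsetP.
- case=> cS /eqP eA /eqP eB.
  have rowS i j : (i, j) \in S -> exists x, i = f x.
    move=> ijS; apply/codomP; rewrite -fA -eA !inE negb_forall.
    by apply/existsP; exists j; rewrite negbK.
  have colS i j : (i, j) \in S -> exists y, j = g y.
    move=> ijS; apply/codomP; rewrite -gB -eB !inE negb_forall.
    by apply/existsP; exists i; rewrite negbK.
  (* Every rook of [S] lies off the lines [A] and [B], hence in the range of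
     [h], so [S] is recovered from its preimage. *)
  have eS : S = h @: (h @^-1: S).
    apply/setP => -[i j]; apply/idP/imsetP => [ijS | [p]].
      have [x ex] := rowS _ _ ijS; have [y ey] := colS _ _ ijS.
      by exists (x, y); rewrite ?inE /h /= -?ex -?ey.
    by rewrite inE => pS ->.
  exists (h @^-1: S) => //; rewrite inE; apply/and3P; split.
  + by rewrite -(card_imset _ hI) -eS.
  + apply/forallP => x; have: f x \in ~: A by rewrite fA codom_f.
    rewrite -eA !inE negb_forall => /existsP[j]; rewrite negbK => xjS.
    have [y ey] := colS _ _ xjS.
    by apply/existsP; exists y; rewrite inE /h /= -ey.
  + apply/forallP => y; have: g y \in ~: B by rewrite gB codom_f.
    rewrite -eB !inE negb_forall => /existsP[i]; rewrite negbK => iyS.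
    have [x ex] := rowS _ _ iyS.
    by apply/existsP; exists x; rewrite inE /h /= -ex.
- case=> T; rewrite inE => /and3P[cT /forallP rT /forallP sT] ->; split.
  + by rewrite card_imset.
  + apply/eqP/setP => i; apply: negb_inj; rewrite -[RHS]in_setC fA inE negb_forall.
    apply/existsP/codomP => [[j] | [x ->]].
      by rewrite negbK => /imsetP[p _ [-> _]]; exists p.1.
    by have /existsP[y xyT] := rT x; exists (g y); rewrite negbK hE.
  + apply/eqP/setP => j; apply: negb_inj; rewrite -[RHS]in_setC gB inE negb_forall.
    apply/existsP/codomP => [[i] | [y ->]].
      by rewrite negbK => /imsetP[p _ [_ ->]]; exists p.2.
    by have /existsP[x xyT] := sT y; exists (f x); rewrite negbK hE.
Qed.

Lemma sum_nonempty_by_card (T : finType) (F : nat -> nat) :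
  (\sum_(A : {set T} | A != set0) F #|A|
    = \sum_(1 <= r < #|T|.+1) 'C(#|T|, r) * F r)%N.
Proof.
rewrite (partition_big (fun A : {set T} => inord #|A| : 'I_#|T|.+1)
                       (fun r => 0 < r)%N) /=; last first.
  by move=> A; rewrite inordK ?ltnS ?max_card // card_gt0.
rewrite big_geq_mkord /=; apply: eq_bigr => r r0.
have cardE (A : {set T}) : (inord #|A| == r) = (#|A| == r).
  by rewrite -val_eqE /= inordK ?ltnS ?max_card.
rewrite (eq_bigr (fun=> F r)) => [|A /andP[_]]; last by rewrite cardE => /eqP->.
rewrite sum_nat_const -card_draws; congr (_ * _)%N.
apply: eq_card => A; rewrite inE unfold_in cardE -card_gt0.
by case: eqP => [->|]; rewrite ?r0 ?andbF.
Qed.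

Lemma card_not_dominating_rook n m k :
  (#|[set S : {set square n m} |
       ~~ dominating (@rook_adj n m) S & #|S| == k]|
    = \sum_(1 <= r < n.+1) \sum_(1 <= c < m.+1)
        'C(n, r) * 'C(m, c) * num_covering (n - r) (m - c) k)%N.
Proof.
rewrite -sum1_card.
rewrite (partition_big (@empty_rows n m) (fun A => A != set0)) /=; last first.
  by move=> S; rewrite inE dominatingPn_rook => /andP[/andP[]].
transitivity (\sum_(A : {set 'I_n} | A != set0)
                \sum_(B : {set 'I_m} | B != set0)
                  num_covering (n - #|A|) (m - #|B|) k)%N.
  apply: eq_bigr => A A0.
  rewrite (partition_big (@empty_cols n m) (fun B => B != set0)) /=; last first.
    by move=> S; rewrite inE dominatingPn_rook => /andP[/andP[/andP[_ ->]]].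
  apply: eq_bigr => B B0; rewrite sum1_card -card_empty_lines.
  apply: eq_card => S; rewrite !inE unfold_in inE dominatingPn_rook.
  have [->|_] := eqVneq (empty_rows S) A; last by rewrite !andbF.
  have [->|_] := eqVneq (empty_cols S) B; last by rewrite !andbF.
  by rewrite A0 B0 !andbT.
rewrite (sum_nonempty_by_card _ (fun r =>
  \sum_(B : {set 'I_m} | B != set0) num_covering (n - r) (m - #|B|) k)%N).
rewrite card_ord; apply: eq_bigr => r _.
rewrite (sum_nonempty_by_card _ (fun c => num_covering (n - r) (m - c) k)).
by rewrite card_ord big_distrr /=; apply: eq_bigr => c _; rewrite mulnA.
Qed.

Lemma num_dominatingD_not (T : finType) (e : rel T) k :
  (num_dominating e k + #|[set S : {set T} | ~~ dominating e S & #|S| == k]|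
    = 'C(#|T|, k))%N.
Proof.
rewrite -card_draws -[RHS](cardsID [set S | dominating e S]).
by congr (_ + _)%N; apply: eq_card => S; rewrite !inE andbC.
Qed.

Theorem theorem1 (n m k : nat) :
  (num_dominating (@rook_adj n m) k)%:Z =
  'C(n * m, k)%:Z
  - \sum_(1 <= r < n.+1) \sum_(1 <= c < m.+1)
      'C(n, r)%:Z * 'C(m, c)%:Z * (num_covering (n - r) (m - c) k)%:Z.
Proof.
have := num_dominatingD_not (@rook_adj n m) k.
rewrite card_prod !card_ord card_not_dominating_rook => <-.
rewrite PoszD (big_morph Posz PoszD (erefl _)).
under eq_bigr do rewrite (big_morph Posz PoszD (erefl _)).
by rewrite addrK.
Qed.
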